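(* Let $d\ge 1$, $m\ge 1$ and $k\ge 2$ be integers, and consider the Conway $(m,k)$-game on $\mathbb{Z}^d$ with maximum attainable row $n_M$. If $m>1$, then $$\left\lfloor \log_{\phi_k}(m) + \log_{\phi_k}\!\left(\frac{(\phi_k+1)^{d-1}}{(\phi_k-1)^d}\right)\right\rfloor \;\le\; n_M \;\le\; \left\lfloor \log_{\phi_k}(m) + \log_{\phi_k}\!\left(\frac{(\phi_k+1)^{d-1}}{(\phi_k-1)^d}\right)\right\rfloor + 1 .$$ Moreover, when $k=2$, for every integer $m\ge 1$, $$\lfloor \log_{\varphi}(m)\rfloor + 3d-2 \;\le\; n_M \;\le\; \lfloor \log_{\varphi}(m)\rfloor + 3d-1,$$ where $\varphi=\frac{1+\sqrt5}{2}$.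
   Context: The Conway $(m,k)$-game on $\mathbb{Z}^d$: the board is $\mathbb{Z}^d$, and each cell may hold any nonnegative integer number of checkers. The row of a cell $x=(x_1,\dots,x_d)$ is its last coordinate $x_d$. Initially every cell with $x_d\le 0$ holds exactly $m$ checkers and every other cell holds none. A move consists of choosing a cell $x$ and a vector $e\in\{\pm e_1,\dots,\pm e_d\}$ (standard unit vectors) such that each of the $k$ cells $x, x+e, \dots, x+(k-1)e$ holds at least one checker; then one checker is removed from each of these $k$ cells and one checker is added to the cell $x+ke$ (a checker at $x$ jumps over $k-1$ checkers in a straight line, removing one checker from each cell jumped over). Row $n$ is attainable if some finite sequence of moves starting from the initial configuration produces a configuration in which some cell with last coordinate $n$ holds at least one checker; $n_M$ denotes the maximum attainable row. The $k$-nacci constant $\phi_k$ is the unique root $x$ with $|x|\ge 1$ of $1+x+\cdots+x^{k-1}-x^k$; it is real and lies in $(1,2)$, and $\phi_2=\varphi=\frac{1+\sqrt5}{2}$. *)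

(* Defs.v *)
From HB Require Import structures.
From mathcomp Require Import all_boot all_order all_algebra.
From mathcomp Require Import classical_sets reals exp.
From mathcomp Require Import ring lra.
Set Implicit Arguments.
Unset Strict Implicit.
Unset Printing Implicit Defensive.
Import Order.TTheory GRing.Theory Num.Theory.
Local Open Scope ring_scope.

(* For d >= 1 the index d.-1.+1 equals d; it gives the last coordinate a name,
   ord_max. The case d = 0 is a junk value and is excluded by hypothesis. *)
Definition cell (d : nat) := 'rV[int]_d.-1.+1.

Definition row_of d (x : cell d) : int := x 0 ord_max.

Definition config (d : nat) := cell d -> nat.

Definition initial d (m : nat) : config d :=
  fun x => if row_of x <= 0 then m else 0%N.

Definition unit_step d (e : cell d) : Prop :=
  exists i, e = delta_mx 0 i \/ e = - delta_mx 0 i.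

Definition legal_jump d k (c : config d) (x e : cell d) : Prop :=
  unit_step e /\ forall i : nat, (i < k)%N -> (0 < c (x + e *+ i)%R)%N.

(* The truncated subtraction is exact after a legal jump: every cell of the
   list holds at least one checker. *)
Definition jump d k (c : config d) (x e : cell d) : config d :=
  fun y => (c y - (y \in [seq x + e *+ i | i <- iota 0 k]%R)
            + (y == x + e *+ k)%R)%N.

Inductive reachable d m k : config d -> Prop :=
| reachable_initial : reachable m k (initial m)
| reachable_jump c x e :
    reachable m k c -> legal_jump k c x e -> reachable m k (jump k c x e).

Definition attainable d m k (n : int) : Prop :=
  exists (c : config d) (x : cell d),
    [/\ reachable m k c, row_of x = n & (0 < c x)%N].

Definition max_attainable_row d m k (n : int) : Prop :=
  attainable d m k n /\ forall n' : int, attainable d m k n' -> n' <= n.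

Definition knacci_poly (R : realType) (k : nat) : {poly R} :=
  \sum_(i < k) 'X^i - 'X^k.

(* The polynomial has exactly one complex root of modulus at least 1 and that
   root is real, so it may be chosen inside R. *)
Definition knacci (R : realType) (k : nat) : R :=
  xget 0 [set x : R | root (knacci_poly R k) x /\ 1 <= `|x|]%classic.

Definition golden (R : realType) : R := (1 + Num.sqrt 5) / 2.

Definition logb (R : realType) (b x : R) : R := ln x / ln b.

(* The next three lemmas show that the choice in [knacci] is neither vacuous
   nor ambiguous. *)
Lemma knacci_rootE (R : realType) k (x : R) :
  root (knacci_poly R k) x = (\sum_(i < k) x ^+ i == x ^+ k).
Proof.
rewrite /root /knacci_poly hornerD hornerN hornerXn horner_sum subr_eq0.
by under eq_bigr do rewrite hornerXn.
Qed.

Lemma knacci_root_eq (R : realType) k (x : R) :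
  root (knacci_poly R k) x -> x ^+ k * (2 - x) = 1.
Proof.
rewrite knacci_rootE => /eqP h.
have := subrX1 x k; rewrite h => {}h.
have -> : x ^+ k * (2 - x) = x ^+ k - (x - 1) * x ^+ k by ring.
by rewrite -h; ring.
Qed.

Lemma knacciP (R : realType) k : (1 < k)%N ->
  [/\ root (knacci_poly R k) (knacci R k), 1 < knacci R k < 2 &
      forall x : R, root (knacci_poly R k) x -> 1 <= `|x| -> x = knacci R k].
Proof.
move=> k1.
have bnd (x : R) : root (knacci_poly R k) x -> 1 <= `|x| -> 1 < x < 2.
  move=> rx x1; have xk := knacci_root_eq rx.
  have nk : 1 <= `|x ^+ k| by rewrite normrX exprn_ege1.
  have x_le : `|2 - x| <= 1.
    have xk1 : `|x ^+ k| * `|2 - x| = 1 by rewrite -normrM xk normr1.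
    by rewrite -[X in _ <= X]xk1 ler_peMl.
  have x_ge1 : 1 <= x by move: x_le; rewrite ler_norml; lra.
  have xk0 : 0 < x ^+ k by rewrite exprn_gt0 //; lra.
  rewrite !lt_neqAle x_ge1 andbT; apply/andP; split.
    apply/eqP => x_1; move: rx; rewrite -x_1 knacci_rootE expr1n.
    under eq_bigr do rewrite expr1n.
    rewrite sumr_const card_ord -[X in _ == X]/(1%:R) eqr_nat => /eqP k_1.
    by rewrite k_1 in k1.
  have : 0 < 2 - x by rewrite -(pmulr_rgt0 _ xk0) xk.
  by rewrite subr_gt0 lt_neqAle.
have nlt (x y : R) : root (knacci_poly R k) x -> root (knacci_poly R k) y ->
    1 < x -> x < y -> False.
  rewrite !knacci_rootE => /eqP rx /eqP ry x1 xy.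
  suff : y ^+ k * x ^+ k < x ^+ k * y ^+ k by rewrite mulrC ltxx.
  rewrite -{1}ry -{2}rx !mulr_suml; apply: ltr_sum => [|i _].
    by apply/hasP; exists (Ordinal (ltnW k1)); rewrite ?mem_index_enum.
  have x0 : 0 < x by lra.
  have y0 : 0 < y by lra.
  have kE (z : R) : z ^+ k = z ^+ i * z ^+ (k - i).
    by rewrite -exprD subnKC // ltnW.
  rewrite !kE !mulrA [y ^+ i * x ^+ i]mulrC.
  by rewrite ltr_pM2l ?mulr_gt0 ?exprn_gt0 // ltrXn2r -?lt0n ?subn_gt0 ?ltW.
have [x rx x1] : exists2 x : R, root (knacci_poly R k) x & 1 <= `|x|.
  have [|x /andP[x1 _] rx] :=
      @poly_ivt R (- knacci_poly R k) 1 2 (ler1n _ 2).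
    rewrite /knacci_poly opprB !hornerE !horner_sum expr1n.
    under eq_bigr do rewrite hornerXn expr1n.
    under [X in _ && (_ <= _ - X)]eq_bigr do rewrite hornerXn.
    have := subrX1 (2 : R) k.
    have -> : (2 - 1 : R) = 1 by ring.
    rewrite mul1r => <-; rewrite sumr_const card_ord.
    by rewrite subr_le0 ler1n (ltnW k1) /=; lra.
  by exists x; [rewrite -rootN | rewrite ger0_norm //; lra].
have [rK K1] : root (knacci_poly R k) (knacci R k) /\ 1 <= `|knacci R k|.
  by apply: (@xgetPex _ _ [set y : R | root _ y /\ 1 <= `|y|]%classic);
    exists x.
have Kb := bnd _ rK K1.
split=> // y ry y1; have yb := bnd _ ry y1.
have [yK|Ky|//] := ltgtP y (knacci R k).
  by case/andP: yb => ? _; case: (nlt _ _ ry rK).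
by case/andP: Kb => ? _; case: (nlt _ _ rK ry).
Qed.

(* Main.v *)
(* A jump read backwards replaces a checker at y by one checker on each of the
   k next cells y + f, ..., y + k f in some direction f. The weight phi^-t of a
   checker at distance t is then preserved, phi being the k-nacci constant.

   Upper bound: for the weight phi^-|y - x|_1 centred at the target x, no jump
   increases the total weight, the initial total is
   m phi^-n (phi / (phi - 1)) ((phi + 1) / (phi - 1))^(d-1) for x in row n, and
   finitely many jumps only use a finite part of it, so this exceeds 1.

   Lower bound: on a ray, keeping M checkers per cell and pushing the excess on
   terminates as soon as the weight is below the weight of the full ray. Hence
   M + 2 p checkers of one cell can be spread over a line with at most M per
   cell whenever p < M / (phi - 1). Repeating this in d - 1 directions
   multiplies M by r = (phi + 1) / (phi - 1) up to rounding: M - (phi - 1) grows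
   at least by r each time, so the fraction 1 - (phi - 1) / m of m r^(d-1) is
   left, and it exceeds 1 / phi when m > phi. A last ray, in the
   vertical direction, reaches row n. For m = 1 and k = 2 the rounding loss is
   too large when starting from a line; starting from 12 checkers spread over a
   plane repairs this. *)

Require Import Defs.
From mathcomp Require Import all_boot all_order all_algebra.
From mathcomp Require Import boolp classical_sets reals exp.
From mathcomp Require Import ring lra zify.
Import Order.TTheory GRing.Theory Num.Theory.
Local Open Scope ring_scope.

(** * Converting checkers *)

Section Conversion.
Set Implicit Arguments.
Unset Strict Implicit.
Context {d m k : nat}.
Implicit Types (a b : config d) (x y f : cell d).

(* The checkers a can be turned into b within every reachable configuration
   that contains a; quantifying over the configuration makes the relation
   additive. *)
Variant converts a b : Prop := Converts of
  forall c : config d, reachable m k c -> (forall x, (a x <= c x)%N) ->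
  exists2 c' : config d, reachable m k c' &
    forall x, (c x + b x <= c' x + a x)%N.

Lemma converts_le a b : (forall x, (b x <= a x)%N) -> converts a b.
Proof. by move=> le_ba; split=> c rc _; exists c => // x; rewrite leq_add2l. Qed.

Lemma converts_trans b a a' : converts a b -> converts b a' -> converts a a'.
Proof.
move=> [ab] [ba']; split=> c rc le_ac; have [c1 rc1 h1] := ab c rc le_ac.
have le_bc1 x : (b x <= c1 x)%N by have := h1 x; have := le_ac x; lia.
have [c2 rc2 h2] := ba' c1 rc1 le_bc1; exists c2 => // x.
by have := h1 x; have := h2 x; lia.
Qed.

Lemma converts_mono a b a' b' :
    converts a b -> (forall x, (a x <= a' x)%N) ->
    (forall x, (b' x <= b x)%N) -> converts a' b'.
Proof.
move=> ab le_a le_b; apply: (@converts_trans a); first exact: converts_le.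
by apply: (@converts_trans b) => //; apply: converts_le.
Qed.

Lemma convertsD a b a' b' : converts a b -> converts a' b' ->
  converts (fun x => a x + a' x)%N (fun x => b x + b' x)%N.
Proof.
move=> [ab] [ab']; split=> c rc le_c.
have [|c1 rc1 h1] := ab c rc; first by move=> x; have := le_c x; lia.
have [|c2 rc2 h2] := ab' c1 rc1.
  by move=> x; have := le_c x; have := h1 x; lia.
by exists c2 => // x; have := h1 x; have := h2 x; lia.
Qed.

Lemma converts_sum n (a b : nat -> config d) :
    (forall i, converts (a i) (b i)) ->
  converts (fun x => \sum_(i < n) a i x)%N (fun x => \sum_(i < n) b i x)%N.
Proof.
move=> ab; elim: n => [|n IHn].
  by apply: converts_le => x; rewrite !big_ord0.
by apply: (converts_mono (convertsD IHn (ab n))) => x; rewrite big_ord_recr.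
Qed.

Lemma convertsM n a b : converts a b ->
  converts (fun x => n * a x)%N (fun x => n * b x)%N.
Proof.
move=> ab; apply: (converts_mono (@converts_sum n (fun=> a) (fun=> b) (fun=> ab))) => x.
- by rewrite sum_nat_const card_ord.
- by rewrite sum_nat_const card_ord.
Qed.

(** The jumper starts at [y + f *+ k], moves along [- f] and lands on [y]. *)
Lemma converts_jump y f : unit_step f ->
  converts (fun x => \sum_(i < k) (x == (y + f *+ i.+1)%R))%N (fun x => x == y).
Proof.
move=> uf; split=> c rc le_c.
have cellE i : (i <= k)%N -> y + f *+ k + (- f) *+ i = y + f *+ (k - i).
  by move=> le_ik; rewrite mulrnBr // mulNrn addrA.
have legal : legal_jump k c (y + f *+ k) (- f).
  split.
    by case: uf => i [] ->; exists i; [right | left; rewrite opprK].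
  move=> i lt_ik; rewrite cellE ?(ltnW lt_ik) //; apply: leq_trans (le_c _).
  have lt_k : ((k - i).-1 < k)%N by lia.
  rewrite (bigD1 (Ordinal lt_k)) //=.
  have -> : (k - i).-1.+1 = (k - i)%N by lia.
  by rewrite eqxx.
exists (jump k c (y + f *+ k) (- f)); first exact: reachable_jump.
move=> x; rewrite /jump cellE // subnn mulr0n addr0.
set s := [seq _ | _ <- _].
suff : ((x \in s) <= \sum_(i < k) (x == (y + f *+ i.+1)%R))%N by lia.
case: (boolP (x \in s)) => // /mapP[i]; rewrite mem_iota /= => lt_ik ->.
have lt_k : ((k - i).-1 < k)%N by lia.
rewrite (bigD1 (Ordinal lt_k)) //=.
have -> : (k - i).-1.+1 = (k - i)%N by lia.
by rewrite cellE ?eqxx // ltnW.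
Qed.

Definition ray y f (b : nat -> nat) n : config d :=
  fun x => (\sum_(i < n) b i * (x == (y + f *+ i)%R))%N.

Lemma converts_ray n y f (b : nat -> nat) (a : nat -> config d) :
    (forall i, converts (a i) (fun x => b i * (x == (y + f *+ i)%R))%N) ->
  converts (fun x => \sum_(i < n) a i x)%N (ray y f b n).
Proof. exact: converts_sum. Qed.

(* The pile b 0 in front keeps M of its checkers, and each of the others is
   replaced by one checker on each of the next k cells. *)
Definition advance (M : nat) (b : nat -> nat) (i : nat) : nat :=
  ((if (i.+1 < k)%N then b i.+1 else 0) + (b 0 - M))%N.

Lemma converts_advance M (b : nat -> nat) y f :
    (0 < k)%N -> unit_step f -> (M <= b 0)%N ->
  converts (fun x => M * (x == y) + ray (y + f)%R f (advance M b) k x)%N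
           (ray y f b k).
Proof.
move=> k0 uf le_M.
set rest := fun x : cell d => (M * (x == y) +
  \sum_(i < k.-1) b i.+1 * (x == (y + f *+ i.+1)%R))%N.
have stay : converts rest rest by apply: converts_le.
have spread := convertsD stay (convertsM (b 0 - M)%N (converts_jump y uf)).
apply: (converts_mono spread) => x; rewrite /rest /ray.
- rewrite -addnA leq_add2l.
  under [leqRHS]eq_bigr => i _ do rewrite /advance -addrA -mulrS mulnDl.
  rewrite big_split /= -big_distrr leq_add2r.
  case: (k) k0 => // K _; rewrite big_ord_recr /= ltnn addn0.
  by apply: leq_sum => i _; rewrite ltnS ltn_ord.
- case: (k) k0 => // K _; rewrite big_ord_recl mulr0n addr0 /=.
  rewrite addnAC -mulnDl subnKC //.
Qed.

End Conversion.

(** * Filling a ray *)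

Section Filling.
Set Implicit Arguments.
Unset Strict Implicit.
Context {R : realType} {d m k : nat}.
Context (k1 : (1 < k)%N).
Implicit Types (x y f : cell d) (b : nat -> nat).

Local Notation phi := (knacci R k).
Local Notation converts := (@converts d m k).
Local Notation advance := (@advance k).

Lemma knacci_gt1 : 1 < phi.
Proof. by have [_ /andP[]] := knacciP R k1. Qed.

Lemma knacci_lt2 : phi < 2.
Proof. by have [_ /andP[]] := knacciP R k1. Qed.

Lemma knacci_gt0 : 0 < phi.
Proof. exact: lt_trans knacci_gt1. Qed.

(** The root equation divided by [phi ^+ k.-1], its terms in reverse order. *)
Lemma sum_knacciV : \sum_(i < k) phi ^- i = phi.
Proof.
have p0 := knacci_gt0; have pn0 : phi != 0 by rewrite gt_eqF.
have [rootK _ _] := knacciP R k1.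
move: rootK; rewrite knacci_rootE => /eqP sumE.
apply: (@mulfI _ (phi ^+ k.-1)); first by rewrite expf_neq0.
rewrite -exprSr prednK ?(ltnW k1) // -sumE mulr_sumr.
rewrite [RHS](reindex_inj rev_ord_inj) /=; apply: eq_bigr => i _.
have -> : k.-1 = (k - i.+1 + i)%N by have := ltn_ord i; lia.
by rewrite exprD mulfK // expf_neq0.
Qed.

Definition potential b : R := \sum_(i < k) (b i)%:R * phi ^- i.

Definition nonincr b := forall i, (b i.+1 <= b i)%N.

Lemma potential_ge0 b : 0 <= potential b.
Proof.
apply: sumr_ge0 => i _; rewrite mulr_ge0 ?ler0n ?invr_ge0 ?exprn_ge0 ?ltW //.
exact: knacci_gt0.
Qed.

(** Keeping [M] checkers in front costs [M]. Spreading the others is free, since the [phi ^- i] for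
    [i] from 1 to [k] sum to 1. Moving the origin on by one cell multiplies by [phi]. *)
Lemma potential_advance M b : (M <= b 0%N)%N ->
  potential (advance M b) = phi * (potential b - M%:R).
Proof.
move=> le_M; have pn0 : phi != 0 by rewrite gt_eqF ?knacci_gt0.
rewrite /potential /advance.
under eq_bigr => i _ do rewrite natrD mulrDl.
rewrite big_split /= -mulr_sumr sum_knacciV natrB //.
suff -> : \sum_(i < k) (if (i.+1 < k)%N then b i.+1 else 0%N)%:R * phi ^- i =
    phi * (\sum_(i < k) (b i)%:R * phi ^- i - (b 0%N)%:R) by ring.
case: k k1 pn0 => // K _; set p := knacci R _ => pn0.
rewrite big_ord_recr /= ltnn mul0r addr0 big_ord_recl /= expr0 invr1 mulr1.
rewrite addrC addKr mulr_sumr; apply: eq_bigr => i _.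
rewrite ltnS ltn_ord /bump /= add1n exprS; field.
by rewrite pn0 expf_neq0.
Qed.

Lemma nonincr_advance M b : nonincr b -> nonincr (advance M b).
Proof.
move=> nb i; rewrite /advance leq_add2r.
by case: ifP => // lt_ik; rewrite (ltn_trans _ lt_ik).
Qed.

Lemma knacci_unbounded (x : R) : exists n, x < phi ^+ n.
Proof.
have p1 := knacci_gt1.
have h : 0 < phi - 1 by rewrite subr_gt0.
have [n lt_n] : exists n, x / (phi - 1) < n%:R.
  exists (Num.bound `|x / (phi - 1)|).
  exact: le_lt_trans (ler_norm _) (archi_boundP (normr_ge0 _)).
exists n; apply: lt_le_trans (_ : 1 + n%:R * (phi - 1) <= _).
  by move: lt_n; rewrite ltr_pdivrMr //; lra.
elim: n {lt_n} => [|n IHn]; first by rewrite mul0r addr0 expr0.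
have pn1 : 1 <= phi ^+ n by rewrite exprn_ege1 // ltW.
by rewrite exprS -natr1; nra.
Qed.

(* With M checkers available on every cell of the ray, the total potential is
   cap. Every advance multiplies the gap between cap and the potential of the
   pending checkers by phi, so that after finitely many steps the front pile
   has height at most M, and so do all the later ones by monotonicity. *)
Lemma converts_fill M b y f : unit_step f -> nonincr b ->
    potential b < M%:R * phi / (phi - 1) ->
  exists n, converts (ray y f (fun=> M) n) (ray y f b k).
Proof.
set cap := _ / _ => uf nb lt_cap.
have [n] := knacci_unbounded (cap / (cap - potential b)).
rewrite ltr_pdivrMr ?subr_gt0 // => {lt_cap}.
elim: n b nb y => [|n IHn] b nb y lt_n.
  (* For [n = 0] the hypothesis reads [cap < cap - potential b], which is impossible. *)
  by move: lt_n; rewrite expr0 mul1r ltrBrDr gtrDl ltNge potential_ge0.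
have [le_b|/ltnW le_M] := leqP (b 0%N) M.
  exists k; apply: converts_le => x; apply: leq_sum => i _.
  rewrite leq_mul2r (leq_trans _ le_b) ?orbT //.
  by elim: {i}(i : nat) => // i; apply: leq_trans.
have [|N conv] := IHn (advance M b) (nonincr_advance M nb) (y + f).
  rewrite potential_advance //; move: lt_n; rewrite exprS.
  congr (_ < _); rewrite -mulrA mulrCA; congr (_ * _).
  have p1 : phi - 1 != 0 by rewrite subr_eq0 gt_eqF ?knacci_gt1.
  by rewrite /cap; field.
exists N.+1; apply: converts_trans (converts_advance y (ltnW k1) uf le_M).
have stay : converts (fun x => M * (x == y))%N (fun x => M * (x == y))%N.
  exact: converts_le.
apply: (converts_mono (convertsD stay conv)) => x //.
rewrite /ray big_ord_recl mulr0n addr0 leq_add2l; apply: leq_sum => i _.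
by rewrite lift0 mulrS addrA.
Qed.

(* Nothing is left behind: all the advances are made with M = 0. *)
Lemma converts_descend n : exists b, [/\ nonincr b, potential b = phi ^+ n &
  forall y f, unit_step f ->
    converts (ray (y + f *+ n) f b k) (fun x => x == y)].
Proof.
elim: n => [|n [b [nb pot conv]]].
  exists (fun i => i == 0%N); split=> [i||y f _] //.
    rewrite /potential; case: k k1 => // K _.
    rewrite big_ord_recl big1 ?addr0 ?expr0 ?invr1 ?mulr1 // => i _.
    by rewrite mul0r.
  apply: converts_le => x; rewrite /ray; case: k k1 => // K _.
  by rewrite big_ord_recl !mulr0n !addr0 mul1n leq_addr.
exists (advance 0 b); split=> [||y f uf]; first exact: nonincr_advance.
  by rewrite potential_advance // pot subr0 exprS.
apply: converts_trans (conv y f uf).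
apply: (converts_mono (converts_advance _ (ltnW k1) uf (leq0n _))) => x //.
by rewrite mul0n add0n mulrSr addrA.
Qed.

End Filling.

(** * From rays to slabs *)

Section Slabs.
Set Implicit Arguments.
Unset Strict Implicit.
Context {R : realType} {d m k : nat} (k1 : (1 < k)%N).
Implicit Types (x y z f : cell d).

Local Notation phi := (knacci R k).
Local Notation converts := (@converts d m k).

(** The first [j] coordinates are free: [slab 0] is a single cell, [slab d.-1] a horizontal
    hyperplane. *)
Definition slab (j : nat) y : config d :=
  fun x => (m * [forall i : 'I_d.-1.+1, (j <= i)%N ==> (x 0 i == y 0 i)%R])%N.

Definition produces (j A : nat) : Prop :=
  forall y, converts (slab j y) (fun x => A * (x == y))%N.

Lemma produces0 : produces 0 m.
Proof.
move=> y; apply: converts_le => x; rewrite /slab leq_mul2l.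
case: (x =P y) => [->|_]; last by rewrite orbT.
suff -> : [forall i : 'I_d.-1.+1, (0 <= i)%N ==> (y 0 i == y 0 i)] by rewrite orbT.
by apply/forallP => i; rewrite eqxx implybT.
Qed.

Lemma slabS j (lt_j : (j < d.-1.+1)%N) y z x :
    (forall i : 'I_d.-1.+1, (j < i)%N -> z 0 i = y 0 i) ->
  slab j z x = ((x 0 (Ordinal lt_j) == z 0 (Ordinal lt_j))%R * slab j.+1 y x)%N.
Proof.
move=> eq_zy; rewrite /slab mulnCA mulnb; congr (_ * nat_of_bool _)%N.
apply/forallP/andP => [h|[/eqP hj /forallP h] i].
  split; first by have := h (Ordinal lt_j); rewrite leqnn.
  apply/forallP => i; apply/implyP => lt_i; rewrite -eq_zy //.
  by have := h i; rewrite (ltnW lt_i).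
apply/implyP; rewrite leq_eqVlt => /predU1P[ji|lt_i].
  have -> : i = Ordinal lt_j by apply: val_inj.
  exact/eqP.
by have := h i; rewrite lt_i eq_zy.
Qed.

(** The [s + i] are distinct, so [t] is hit at most once. Keeping [s <= t] in the bound is what
    separates opposite rays later. *)
Lemma leq_sum_hits (s t : int) n :
  (\sum_(i < n) (t == s + i%:Z)%R <= (s <= t)%R)%N.
Proof.
have [le_st|lt_ts] /= := leP s t; last first.
  by rewrite big1 // => i _; case: eqP => // E; lia.
have [lt_n|le_n] := ltnP `|t - s|%N n.
  rewrite (bigD1 (Ordinal lt_n)) //= big1 ?addn0 => [|i]; first exact: leq_b1.
  by rewrite -val_eqE /=; case: eqP => // E /eqP; lia.
rewrite big1 // => i _; have lt_i := ltn_ord i.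
by case: eqP => // E; lia.
Qed.

(** The slab through [y] gives [M] checkers. On either side, the ray of parallel slabs gives [M] per
    cell; this can be gathered into [p] on each of the first [k] cells, of potential [p * phi], and
    then into [p] checkers at [y]. *)
Lemma produces_line j M p : (j < d.-1.+1)%N ->
    produces j M -> p%:R < M%:R / (phi - 1) -> produces j.+1 (M + p * 2).
Proof.
move=> lt_j prod lt_p y; set o := Ordinal lt_j.
have side f : unit_step f -> exists n,
    converts (fun x => \sum_(i < n) slab j ((y + f) + f *+ i)%R x)%N
             (fun x => p * (x == y))%N.
  move=> uf; have [||n conv] := @converts_fill R d m k k1 M (fun=> p) (y + f) f uf.
  - by [].
  - rewrite /potential -mulr_sumr sum_knacciV // mulrAC ltr_pM2r //.
    exact: knacci_gt0.
  exists n; apply: (@converts_trans _ _ _ (ray (y + f) f (fun=> p) k)).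
    apply: converts_trans conv.
    exact: (@converts_ray _ _ _ n (y + f) f (fun=> M)
             (fun i => slab j (y + f + f *+ i)) (fun i => prod _)).
  apply: (converts_mono (convertsM p (converts_jump y uf))) => x //.
  rewrite big_distrr /=; apply: leq_sum => i _.
  by rewrite mulrS addrA.
have e0 : unit_step (delta_mx 0 o : cell d) by exists o; left.
have e1 : unit_step (- delta_mx 0 o : cell d) by exists o; right.
have [n0 conv0] := side _ e0; have [n1 conv1] := side _ e1.
have conv := convertsD (prod y) (convertsD conv0 conv1).
have coord f i l : (y + f + f *+ i) 0 l = y 0 l + f 0 l *+ i.+1.
  by rewrite !mxE mulmxnE -addrA -mulrS.
have agree f i (l : 'I_d.-1.+1) : f = delta_mx 0 o \/ f = - delta_mx 0 o ->
    (j < l)%N -> (y + f + f *+ i) 0 l = y 0 l.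
  move=> fE lt_l; rewrite coord.
  suff -> : f 0 l = 0 by rewrite mul0rn addr0.
  have ne_lo : (l == o) = false by rewrite -val_eqE /= gtn_eqF.
  by case: fE => ->; rewrite !mxE ne_lo andbF ?oppr0.
apply: (converts_mono conv) => x; last first.
  by case: (x == y); rewrite ?muln1 ?muln0 ?muln1; lia.
rewrite (@slabS j lt_j y y) //.
have expand f : f = delta_mx 0 o \/ f = - delta_mx 0 o -> forall i,
    slab j (y + f + f *+ i) x =
    ((x 0 o == y 0 o + f 0 o *+ i.+1)%R * slab j.+1 y x)%N.
  by move=> fE i; rewrite -coord; apply: slabS => l; apply: agree.
under eq_bigr => i _ do rewrite (expand _ (or_introl erefl)).
under [X in (_ + (_ + X) <= _)%N]eq_bigr => i _ do
  rewrite (expand _ (or_intror erefl)).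
rewrite -!big_distrl /= -!mulnDl -[leqRHS]mul1n leq_mul2r; apply/orP; right.
rewrite !mxE !eqxx /=.
rewrite [x 0 _ == _](_ : _ = (x 0 o == y 0 o)) //.
(* The cell [x] can be level with [y], on its positive side or on its negative side; these exclude
   each other. Signs are reversed for the negative side. *)
have hits0 := leq_sum_hits (y 0 o + 1) (x 0 o) n0.
have hits1 := leq_sum_hits (- y 0 o + 1) (- x 0 o) n1.
apply: leq_trans (leq_add (leqnn _) (leq_add _ _)) _.
- apply: leq_trans hits0; apply: leq_sum => i _.
  by apply/eq_leq; congr nat_of_bool; lia.
- apply: leq_trans hits1; apply: leq_sum => i _.
  by apply/eq_leq; congr nat_of_bool; lia.
- lia.
Qed.

(** The ceiling of [t] minus 1, since [produces_line] asks for a strict inequality. *)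
Lemma floor_pred (t : R) : 0 < t -> exists p, t - 1 <= p%:R < t.
Proof.
move=> t0; have ex_p : exists p, t <= p.+1%:R.
  exists (Num.bound t); apply/ltW/(lt_le_trans (archi_boundP (ltW t0))).
  by rewrite ler_nat.
case: (ex_minnP ex_p) => p le_t min_p; exists p; apply/andP; split.
  by move: le_t; rewrite -natr1; lra.
case: p min_p {le_t} => // p min_p.
by rewrite ltNge; apply/negP => /min_p; rewrite ltnn.
Qed.

(* The excess of M over phi - 1 grows by the factor (phi + 1) / (phi - 1)
   with each dimension; phi - 1 absorbs the rounding of p. *)
Lemma produces_dim j A n : (0 < A)%N -> produces j A -> (j + n <= d.-1)%N ->
  exists2 M, produces (j + n) M &
    (A%:R - (phi - 1)) * ((phi + 1) / (phi - 1)) ^+ n <= M%:R - (phi - 1).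
Proof.
move=> A0 prodA; have p1 : 0 < phi - 1 by rewrite subr_gt0 knacci_gt1.
suff step : (j + n <= d.-1)%N -> exists M, [/\ (0 < M)%N, produces (j + n) M &
    (A%:R - (phi - 1)) * ((phi + 1) / (phi - 1)) ^+ n <= M%:R - (phi - 1)].
  by case/step => M [_ ? ?]; exists M.
elim: n => [|n IHn] le_n; first by exists A; rewrite addn0 expr0 mulr1.
have [|M [M0 prodM le_M]] := IHn; first by lia.
have [|p /andP[le_p lt_p]] := @floor_pred (M%:R / (phi - 1)).
  by rewrite divr_gt0 ?ltr0n.
exists (M + p * 2)%N; rewrite addnS; split; first by rewrite addn_gt0 M0.
  by apply: produces_line lt_p; rewrite // ltnS; lia.
rewrite exprSr [leLHS]mulrA.
have r0 : 0 <= (phi + 1) / (phi - 1) by rewrite divr_ge0; lra.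
apply: (le_trans (ler_wpM2r r0 le_M)); rewrite natrD natrM.
(* Rounding costs at most 2, and [phi - 1] is the fixed point of [t -> r * t - 2] for
   [r = (phi + 1) / (phi - 1)]. *)
have -> : (M%:R - (phi - 1)) * ((phi + 1) / (phi - 1)) =
    M%:R + (M%:R / (phi - 1)) * 2 - (phi + 1) :> R.
  by field; rewrite gt_eqF.
lra.
Qed.

(** Going backwards from row [n] down to row 0 leaves the potential [phi ^+ n]; the downward ray of
    horizontal slabs supplies it when it is below [M * phi / (phi - 1)]. *)
Lemma attainable_row n M : produces d.-1 M ->
  phi ^+ n * (phi - 1) < M%:R * phi -> attainable d m k n%:Z.
Proof.
move=> prod lt_n; set f : cell d := - delta_mx 0 ord_max.
have uf : unit_step f by exists ord_max; right.
have p1 : 0 < phi - 1 by rewrite subr_gt0 knacci_gt1.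
have [b [nb pot desc]] := @converts_descend R d m k k1 n.
have [|N fill] := @converts_fill R d m k k1 M b 0 f uf nb.
  by rewrite pot ltr_pdivlMr.
have prods : converts (fun x => \sum_(i < N) slab d.-1 (0 + f *+ i)%R x)%N
                      (ray 0 f (fun=> M) N).
  exact: (@converts_ray _ _ _ N 0 f (fun=> M)
           (fun i => slab d.-1 (0 + f *+ i)) (fun i => prod _)).
have := desc (- f *+ n) f uf; rewrite mulNrn addNr => {}desc.
have [conv] := converts_trans (converts_trans prods fill) desc.
(* The slabs lie in distinct rows, none above row 0. *)
have le_init x : (\sum_(i < N) slab d.-1 (0 + f *+ i)%R x <= initial m x)%N.
  have lt_d := ltnSn d.-1.
  have lastE i : (f *+ i) 0 ord_max = - i%:Z.
    by rewrite mulmxnE !mxE !eqxx mulNrn natz.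
  under eq_bigr => i _.
    rewrite (slabS lt_d (y := 0)) => [|l]; last by have := ltn_ord l; lia.
    over.
  rewrite -big_distrl /=.
  have -> : slab d.-1.+1 0 x = m.
    rewrite /slab (_ : [forall _, _]) ?muln1 //; apply/forallP => i.
    by rewrite leqNgt ltn_ord.
  have hits := leq_sum_hits 0 (- x 0 ord_max) N.
  apply: (@leq_trans ((0 <= - x 0 ord_max)%R * m)%N).
    rewrite leq_mul2r; apply/orP; right; apply: leq_trans hits.
    apply: leq_sum => i _; apply/eq_leq; congr nat_of_bool.
    rewrite add0r (_ : Ordinal lt_d = ord_max) ?lastE; last exact: val_inj.
    by rewrite add0r -[RHS]eqr_opp opprK.
  by rewrite /initial /row_of oppr_ge0; case: ifP; rewrite ?mul1n ?mul0n.
have [c' rc' le_c'] := conv _ (@reachable_initial d m k) le_init.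
exists c', (- (f *+ n)); split => //.
  by rewrite /row_of !mxE mulmxnE !mxE !eqxx mulNrn opprK natz.
have := le_c' (- (f *+ n)); rewrite eqxx.
by have := le_init (- (f *+ n)); lia.
Qed.

End Slabs.

(** * Twelve checkers in the plane, for m = 1 and k = 2 *)

Section Plane.
Set Implicit Arguments.
Unset Strict Implicit.
Context {d : nat} (d1 : (1 < d.-1.+1)%N).
Implicit Types (x y : cell d) (u v e : int * int).

Let o0 : 'I_d.-1.+1 := Ordinal (ltnW d1).
Let o1 : 'I_d.-1.+1 := Ordinal d1.

Definition embed y u : cell d :=
  y + (u.1 *: delta_mx 0 o0 + u.2 *: delta_mx 0 o1).

Definition pile y (s : seq (int * int)) : config d :=
  fun x => (\sum_(u <- s) (x == embed y u))%N.

Definition add_pair u v := (u.1 + v.1, u.2 + v.2).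

Definition split_checker (s : seq (int * int))
    (mv : (int * int) * (int * int)) :=
  let: (u, e) := mv in
  [:: add_pair u e, add_pair (add_pair u e) e & rem u s].

(** A quarter turn: its iterates carry the quadrant of [arm] to four disjoint ones. *)
Definition turn u := (- u.2, u.1).

(* A quarter of the splittings, found by search: three checkers of the origin
   are spread over twelve cells of the quadrant of the cells (a, b) with
   0 < a and 0 <= b. *)
Definition arm : seq ((int * int) * (int * int)) :=
  [:: ((0, 0), (1, 0)); ((0, 0), (1, 0)); ((0, 0), (1, 0));
      ((1, 0), (0, 1)); ((1, 0), (0, 1)); ((1, 1), (1, 0)); ((2, 0), (0, 1));
      ((2, 0), (1, 0)); ((1, 2), (0, 1)); ((2, 1), (0, 1)); ((2, 2), (1, 0))].

Definition arms :=
  flatten [seq [seq (iter r turn mv.1, iter r turn mv.2) | mv <- arm]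
          | r <- iota 0 4].

Definition spread := foldl split_checker (nseq 12 (0, 0)) arms.

(** The 12 checkers end on 56 distinct cells, fourteen per quadrant, so one checker per cell of the
    plane is enough. *)
Lemma spread_uniq : uniq spread.
Proof. by vm_compute. Qed.

Lemma arms_unit :
  all (fun mv => mv.2 \in [:: (1, 0); (0, 1); (-1, 0); (0, -1)]) arms.
Proof. by vm_compute. Qed.

Lemma embed_add y u e : embed y (add_pair u e) = embed y u + embed 0 e.
Proof. by rewrite /embed /= !scalerDl add0r -[in RHS]addrA [in RHS]addrACA. Qed.

Lemma converts_split y s mv :
    mv.2 \in [:: (1, 0); (0, 1); (-1, 0); (0, -1)] ->
  @converts d 1 2 (pile y (split_checker s mv)) (pile y s).
Proof.
case: mv => u e /= e_unit; have ue : unit_step (embed 0 e).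
  move: e_unit; rewrite !inE => /or4P[] /eqP ->;
    rewrite /embed /= !(scale0r, scale1r, scaleN1r, add0r, addr0);
    by [exists o0; left | exists o1; left | exists o0; right | exists o1; right].
(* If [u] is not in [s], then [rem] leaves [s] unchanged and the splitting only adds checkers. *)
have [us|us] := boolP (u \in s); last first.
  apply: converts_le => x.
  by rewrite /pile /= !big_cons rem_id // addnA leq_addl.
have stay : @converts d 1 2 (pile y (rem u s)) (pile y (rem u s)).
  exact: converts_le.
apply: (converts_mono (convertsD (converts_jump (embed y u) ue) stay)) => x.
  rewrite /pile /= !big_cons !embed_add.
  move: (embed y u) (embed 0 e) => z f; rewrite big_ord_recl big_ord1.
  by rewrite lift0 mulr1n mulr2n addrA -addnA.
by rewrite /pile (big_rem u us).
Qed.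

Lemma produces_plane : @produces d 1 2 2 12.
Proof.
move=> y; apply: (@converts_trans _ _ _ (pile y (nseq 12 (0, 0)))); last first.
  apply: converts_le => x; rewrite /pile big_nseq /embed !scale0r !addr0.
  by rewrite iter_addn_0 mulnC.
have le_pile : forall x, (pile y spread x <= @slab d 1 2 y x)%N.
  move=> x; rewrite /slab mul1n /pile.
  have coord u l : embed y u 0 l =
      y 0 l + (u.1 * (l == o0)%:R + u.2 * (l == o1)%:R).
    by rewrite /embed !mxE.
  (* Only [u = v] can be sent to [x], so the pile at [x] is at most the multiplicity of [v] in
     [spread]. *)
  set v := (x 0 o0 - y 0 o0, x 0 o1 - y 0 o1).
  have le_v u : (((x == embed y u) : nat) <= (u == v))%N.
    case: (x =P embed y u) => // xE; suff -> : v = u by rewrite eqxx.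
    rewrite /v xE !coord !eqxx (_ : (o0 == o1) = false) // (_ : (o1 == o0) = false) //.
    by case: u {xE} => a b /=; congr pair; ring.
  case: forallP => [in_plane|out].
    apply: (@leq_trans (count_mem v spread)); last first.
      by rewrite count_uniq_mem ?leq_b1 ?spread_uniq.
    by rewrite -sum1_count [leqRHS]big_mkcond /=;
      apply: leq_sum => u _; apply: leq_trans (le_v u) _; case: (u == v).
  rewrite big1 // => u _; case: (x =P embed y u) => // xE.
  case: out => i; apply/implyP => lt_i; rewrite xE coord.
  have -> : (i == o0) = false by apply/eqP => io; move: lt_i; rewrite io.
  have -> : (i == o1) = false by apply/eqP => io; move: lt_i; rewrite io.
  by rewrite !mulr0 !addr0.
apply: (@converts_trans _ _ _ (pile y spread)); first exact: converts_le.
rewrite /spread; elim: arms arms_unit (nseq _ _) => [|mv mvs IH] /=.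
  by move=> _ s; apply: converts_le.
move=> /andP[mv_unit mvs_unit] s.
exact: converts_trans (IH mvs_unit _) (converts_split _ _ mv_unit).
Qed.
End Plane.

(** * Upper bound *)

Section Upper.
Set Implicit Arguments.
Unset Strict Implicit.
Context {R : realType} {d m k : nat} (k1 : (1 < k)%N).
Implicit Types (x y z e f : cell d) (s : seq (cell d)).

Local Notation phi := (knacci R k).

Let p1 : 1 < phi := knacci_gt1 k1.
Let p0 : 0 < phi := knacci_gt0 k1.

(** The product form lets the sum over a box factor by coordinates. *)
Definition weight x y : R := \prod_i phi ^- `|(y 0 i - x 0 i)%R|%N.

Lemma weight_gt0 x y : 0 < weight x y.
Proof. by apply: prodr_gt0 => i _; rewrite invr_gt0 exprn_gt0. Qed.

Lemma weight_step x y f : unit_step f -> weight x y / phi <= weight x (y + f).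
Proof.
move=> [i0 fE]; rewrite /weight (bigD1 i0) //= [leRHS](bigD1 i0) //=.
have eq_rest i : i != i0 -> (y + f) 0 i = y 0 i.
  by move=> /negbTE ne; case: fE => ->; rewrite !mxE ne andbF ?oppr0 addr0.
under [in leRHS]eq_bigr => i ne_i do rewrite eq_rest //.
rewrite mulrAC ler_wpM2r //.
  by apply: prodr_ge0 => i _; rewrite invr_ge0 exprn_ge0 ?ltW.
rewrite -invfM -exprSr lef_pV2 ?posrE ?exprn_gt0 //.
apply: ler_weXn2l; first exact: ltW.
by case: fE => ->; rewrite !mxE !eqxx mulr1n; move: (y 0 i0) (x 0 i0) => a b; lia.
Qed.

Lemma weight_steps x y f n : unit_step f ->
  weight x y * phi ^- n <= weight x (y + f *+ n).
Proof.
move=> uf; elim: n => [|n IHn]; first by rewrite expr0 invr1 mulr1 addr0.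
rewrite mulrSr addrA; apply: le_trans (weight_step _ _ uf).
by rewrite exprSr invfM mulrA ler_wpM2r // invr_ge0 ltW.
Qed.

(** Each cell jumped from or over is [i.+1] steps behind the landing cell for some [i < k], which
    loses at most the factor [phi ^- i.+1]; these factors sum to 1. *)
Lemma weight_jump x y e : unit_step e ->
  weight x (y + e *+ k) <= \sum_(i < k) weight x (y + e *+ i).
Proof.
move=> ue; have ue' : unit_step (- e).
  by case: ue => i [] ->; exists i; [right | left; rewrite opprK].
rewrite (reindex_inj rev_ord_inj) /=.
have sum1 : \sum_(i < k) phi ^- i.+1 = 1.
  under eq_bigr => i _ do rewrite exprSr invfM.
  by rewrite -mulr_suml sum_knacciV // divff ?gt_eqF.
rewrite -[leLHS]mulr1 -sum1 mulr_sumr; apply: ler_sum => i _.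
apply: (le_trans (weight_steps _ _ _ ue')); rewrite mulNrn -addrA -mulrnBr //.
Qed.

Lemma uniq_line y e n : unit_step e -> uniq [seq y + e *+ i | i <- iota 0 n].
Proof.
move=> [l eE]; rewrite map_inj_uniq ?iota_uniq // => i j /addrI.
move/matrixP/(_ 0 l); case: eE => ->; rewrite !mulmxnE !mxE !eqxx ?mulNrn !natz.
  by case.
by move/oppr_inj; case.
Qed.

Lemma sum_indicator s s' (w : cell d -> R) :
  uniq s -> uniq s' -> {subset s' <= s} ->
  \sum_(y <- s) (y \in s')%:R * w y = \sum_(y <- s') w y.
Proof.
move=> us us' sub; under eq_bigr => y _ do rewrite mulr_natl mulrb.
rewrite -big_mkcond -big_filter; apply: perm_big; apply: uniq_perm => //.
  exact: filter_uniq.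
by move=> y; rewrite mem_filter; apply/andb_idr/sub.
Qed.

(* The sum over the whole board is infinite; s0 collects the cells that the
   moves leading to c have touched. *)
Lemma weight_reachable x (c : config d) : reachable m k c ->
  exists s0, forall s, uniq s -> {subset s0 <= s} ->
    \sum_(y <- s) (c y)%:R * weight x y <=
    \sum_(y <- s) (initial m y)%:R * weight x y.
Proof.
elim=> [|{}c z e _ [s0 IH] [ue legal]]; first by exists [::].
set line := [seq z + e *+ i | i <- iota 0 k].
exists (s0 ++ line ++ [:: z + e *+ k]) => s us sub.
apply: le_trans (IH s us _); last by move=> y ys; rewrite sub // mem_cat ys.
have jumpE y : (jump k c z e y)%:R * weight x y = (c y)%:R * weight x y -
    (y \in line)%:R * weight x y + (y \in [:: z + e *+ k])%:R * weight x y.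
  rewrite /jump -/line natrD natrB ?inE; first by ring.
  by case: (boolP (y \in line)) => // /mapP[i]; rewrite mem_iota => /andP[_ /legal] + ->.
under eq_bigr do rewrite jumpE.
rewrite big_split sumrB /= !sum_indicator ?uniq_line //.
- have -> : \sum_(y <- line) weight x y = \sum_(i < k) weight x (z + e *+ i).
    by rewrite big_map -[k in iota 0 k]subn0 big_mkord.
  by rewrite big_seq1; have := weight_jump x z ue; lra.
- by move=> y ys; rewrite sub // !mem_cat ys !orbT.
- by move=> y ys; rewrite sub // !mem_cat ys !orbT.
Qed.

Lemma sum_geometric n : \sum_(i < n) phi ^- i < phi / (phi - 1).
Proof.
have h : 0 < phi - 1 by rewrite subr_gt0.
suff -> : \sum_(i < n) phi ^- i = phi / (phi - 1) * (1 - phi ^- n).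
  by rewrite gtr_pMr ?divr_gt0 // gtrBl invr_gt0 exprn_gt0.
elim: n => [|n IHn]; first by rewrite big_ord0 expr0 invr1 subrr mulr0.
by rewrite big_ord_recr IHn /= exprS; field; rewrite expf_neq0 ?gt_eqF.
Qed.

Lemma sum_two_sided N :
  \sum_(j < N + N.+1) phi ^- `|(j%:Z - N%:Z)%R|%N < (phi + 1) / (phi - 1).
Proof.
have h : 0 < phi - 1 by rewrite subr_gt0.
rewrite big_split_ord /= (reindex_inj rev_ord_inj) /=.
under eq_bigr => i _.
  rewrite (_ : `|_|%N = i.+1) ?exprSr ?invfM; last by have := ltn_ord i; lia.
  over.
under [X in _ + X < _]eq_bigr => i _.
  rewrite (_ : `|_|%N = i); last by lia.
  over.
rewrite -mulr_suml.
have -> : (phi + 1) / (phi - 1) = phi / (phi - 1) / phi + phi / (phi - 1).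
  by field; rewrite !gt_eqF.
by rewrite ltrD ?sum_geometric // ltr_pM2r ?invr_gt0 ?sum_geometric.
Qed.

(** The factor of the last coordinate: cells above row 0 are empty, and row [- i] is at distance
    [n + i] from row [n]. *)
Lemma sum_one_sided n N :
  \sum_(j < N + N.+1) (j%:Z - N%:Z <= 0)%R%:R * phi ^- `|(j%:Z - N%:Z - n%:Z)%R|%N
    < phi ^- n * (phi / (phi - 1)).
Proof.
rewrite big_split_ord /= (reindex_inj rev_ord_inj) /= big_ord_recl [X in _ + (_ + X)]big1.
  under eq_bigr => i _.
    rewrite (_ : _ <= 0) ?mul1r; last by have := ltn_ord i; lia.
        rewrite (_ : `|_|%N = (n + i.+1)%N) ?exprD ?invfM; last by have := ltn_ord i; lia.
    over.
  rewrite -mulr_sumr /= addn0 addr0 subrr lexx mul1r sub0r abszN absz_nat.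
  rewrite -[X in _ + X]mulr1 -mulrDr ltr_pM2l ?invr_gt0 ?exprn_gt0 //.
  apply: le_lt_trans (sum_geometric N.+1); rewrite big_ord_recl expr0 invr1 addrC.
  by [].
by move=> i _; rewrite (_ : (_ <= 0) = false) ?mul0r //; rewrite /= /bump; lia.
Qed.

Definition box_cell z N (h : {ffun 'I_d.-1.+1 -> 'I_(N + N.+1)}) : cell d :=
  \row_i (z 0 i + ((h i)%:Z - N%:Z)).

Lemma box_cell_inj z N : injective (@box_cell z N).
Proof.
move=> h h' /matrixP eq_hh'; apply/ffunP => i; apply: val_inj.
by have := eq_hh' 0 i; rewrite !mxE => /addrI/addIr; case.
Qed.

Lemma box_cover z s :
  exists N, forall y, y \in s -> exists h, y = @box_cell z N h.
Proof.
exists (\max_(y <- s) \max_i `|(y 0 i - z 0 i)%R|%N) => y ys; set N := \max_(_ <- _) _.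
have le_N i : (`|(y 0 i - z 0 i)%R| <= N)%N.
  apply: (@leq_trans (\max_l `|(y 0 l - z 0 l)%R|%N)); first exact: leq_bigmax.
  exact: (@leq_bigmax_seq _ _ xpredT (fun y => \max_l `|(y 0 l - z 0 l)%R|%N)).
have lt_N i : (`|(y 0 i - z 0 i + N%:Z)%R| < N + N.+1)%N by have := le_N i; lia.
exists [ffun i => Ordinal (lt_N i)]; apply/matrixP => u i.
by rewrite ord1 !mxE ffunE /=; have := le_N i; lia.
Qed.

(** Enlarging [s] to a box turns the sum into a product of one geometric sum per coordinate. *)
Lemma weight_initial_lt x n s : (0 < m)%N -> row_of x = n%:Z -> uniq s ->
  \sum_(y <- s) (initial m y)%:R * weight x y <
  m%:R * phi ^- n * (phi / (phi - 1)) * ((phi + 1) / (phi - 1)) ^+ d.-1.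
Proof.
move=> m0 rowx us.
(* The projection of [x] to row 0: the last offset in the box is then the row itself, and the others
   are offsets from [x]. *)
pose z : cell d := \row_i (if i == ord_max then 0 else x 0 i).
have [N cover] := box_cover z s.
set t := [seq @box_cell z N h | h <- enum {: {ffun 'I_d.-1.+1 -> 'I_(N + N.+1)}}].
have ut : uniq t by rewrite map_inj_uniq ?enum_uniq //; apply: box_cell_inj.
have sub : {subset s <= t}.
  by move=> y /cover[h ->]; apply: map_f; rewrite mem_enum.
rewrite -(sum_indicator _ ut us sub).
pose F (i : 'I_d.-1.+1) (j : 'I_(N + N.+1)) : R :=
  (if i == ord_max then (j%:Z - N%:Z <= 0)%R%:R else 1) *
  phi ^- `|(z 0 i + (j%:Z - N%:Z) - x 0 i)%R|%N.
have F0 i j : 0 <= F i j.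
  apply: mulr_ge0; last by rewrite invr_ge0 exprn_ge0 // ltW.
  by case: ifP => _; rewrite ?ler0n ?ler01.
have boxE h : (initial m (@box_cell z N h))%:R * weight x (box_cell z h) =
    m%:R * \prod_i F i (h i).
  rewrite /F big_split /= mulrA; congr (_ * _); last first.
    by apply: eq_bigr => i _; rewrite !mxE.
  rewrite (bigD1 ord_max) //= big1 => [|i /negbTE->] //.
  rewrite eqxx mulr1 /initial /row_of !mxE eqxx add0r.
  by case: ifP; rewrite ?mulr1 ?mulr0.
apply: (@le_lt_trans _ _ (m%:R * \prod_i \sum_j F i j)).
  rewrite bigA_distr_bigA mulr_sumr /t big_map big_enum /=.
  apply: ler_sum => h _; rewrite boxE ler_piMl ?lern1 ?leq_b1 //.
  by rewrite mulr_ge0 // prodr_ge0.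
rewrite -!mulrA ltr_pM2l ?ltr0n // (bigD1 ord_max) //= !mulrA.
have last_lt : \sum_j F ord_max j < phi ^- n * (phi / (phi - 1)).
  apply: le_lt_trans (sum_one_sided n N); apply: ler_sum => j _.
  by rewrite /F mxE eqxx -[x 0 _]/(row_of x) rowx add0r.
have h1 : 0 < phi - 1 by rewrite subr_gt0.
have others : \prod_(i < d.-1.+1 | i != ord_max) \sum_j F i j <=
    ((phi + 1) / (phi - 1)) ^+ d.-1.
  have -> : ((phi + 1) / (phi - 1)) ^+ d.-1 =
      \prod_(i < d.-1.+1 | i != ord_max) ((phi + 1) / (phi - 1)).
    by rewrite prodr_const cardC1 card_ord.
  apply: ler_prod => i /negbTE ne_i; rewrite sumr_ge0 //=.
  apply: le_trans (ltW (sum_two_sided N)); apply: ler_sum => j _.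
  by rewrite /F mxE ne_i mul1r addrAC subrr add0r.
apply: le_lt_trans (ler_wpM2l (sumr_ge0 _ _) others) _ => //.
rewrite ltr_pM2r; first by rewrite -mulrA.
by rewrite exprn_gt0 // divr_gt0 // addr_gt0.
Qed.

(** The checker on [x] alone weighs 1, so the initial total exceeds 1. *)
Lemma attainable_lt n : (0 < m)%N -> attainable d m k n%:Z ->
  phi ^+ n * (phi - 1) < m%:R * phi * ((phi + 1) / (phi - 1)) ^+ d.-1.
Proof.
move=> m0 [c [x [rc rowx cx]]]; have [s0 le_s0] := weight_reachable x rc.
have := weight_initial_lt m0 rowx (undup_uniq (x :: s0)).
have sub : {subset s0 <= undup (x :: s0)}.
  by move=> y ys; rewrite mem_undup inE ys orbT.
move/(le_lt_trans (le_s0 _ (undup_uniq _) sub)).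
have xs : x \in undup (x :: s0) by rewrite mem_undup mem_head.
rewrite (big_rem x xs) /=.
have -> : weight x x = 1.
  by rewrite /weight big1 // => i _; rewrite subrr absz0 expr0 invr1.
have rest : 0 <= \sum_(y <- rem x (undup (x :: s0))) (c y)%:R * weight x y.
  by apply: sumr_ge0 => y _; rewrite mulr_ge0 ?ler0n // ltW // weight_gt0.
have cx1 : 1 <= (c x)%:R :> R by rewrite ler1n.
move=> lt1; have {lt1 rest cx1} : 1 < m%:R * phi ^- n * (phi / (phi - 1)) *
    ((phi + 1) / (phi - 1)) ^+ d.-1 by apply: le_lt_trans lt1; lra.
have h : 0 < phi - 1 by rewrite subr_gt0.
have pn : 0 < phi ^+ n by rewrite exprn_gt0.
set r := _ ^+ d.-1; rewrite -(ltr_pM2l (mulr_gt0 pn h)) mulr1.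
congr (_ < _); field; by rewrite !gt_eqF.
Qed.

End Upper.

(** * Attainable rows *)

Section Rows.
Set Implicit Arguments.
Unset Strict Implicit.
Context {R : realType} {d m k : nat} (d0 : (0 < d)%N) (m0 : (0 < m)%N).
Context (k1 : (1 < k)%N).

Local Notation phi := (knacci R k).
Let W : R := (phi + 1) ^+ (d - 1) / (phi - 1) ^+ d.
Let L : int := Num.floor (logb phi m%:R + logb phi W).

Let p1 : 1 < phi := knacci_gt1 k1.
Let p0 : 0 < phi := knacci_gt0 k1.
Let h : 0 < phi - 1. Proof. by rewrite subr_gt0. Qed.

Lemma ratio_ge1 : 1 <= (phi + 1) / (phi - 1).
Proof. by rewrite ler_pdivlMr //; lra. Qed.

Lemma capacityE : W = ((phi + 1) / (phi - 1)) ^+ d.-1 / (phi - 1).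
Proof.
rewrite /W expr_div_n -mulrA -invfM -exprSr prednK //.
by rewrite -subn1.
Qed.

Let W_gt0 : 0 < W.
Proof. by rewrite capacityE divr_gt0 // exprn_gt0 // (lt_le_trans ltr01 ratio_ge1). Qed.

Let X : R := m%:R * W.
Let X_gt0 : 0 < X. Proof. by rewrite mulr_gt0 ?ltr0n. Qed.

Let L_E : L = Num.floor (ln X / ln phi).
Proof. by rewrite /L /logb -mulrDl -lnM // posrE ltr0n. Qed.

Let lnp : 0 < ln phi. Proof. exact: ln_gt0. Qed.

Lemma le_floor_log n : (n%:Z <= L) = (phi ^+ n <= X).
Proof.
rewrite L_E floor_ge_int ler_pdivlMr // mulr_natl -lnXn //.
by rewrite ler_ln ?posrE // exprn_gt0.
Qed.

Lemma attainable_le n : attainable d m k n%:Z -> n%:Z <= L + 1.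
Proof.
move/(@attainable_lt R d m k k1 n m0) => lt_n.
have {}lt_n : phi ^+ n < phi * X.
  rewrite /X capacityE -(ltr_pM2r h); apply: lt_le_trans lt_n _.
  by rewrite le_eqVlt; apply/orP; left; apply/eqP; field; rewrite gt_eqF.
rewrite -lerBlDr L_E floor_ge_int ler_pdivlMr // rmorphB /= mulrBl mul1r.
rewrite mulr_natl -lnXn // lerBlDr -lnM ?posrE //.
rewrite ler_ln ?posrE ?exprn_gt0 //; last exact: mulr_gt0.
by rewrite mulrC ltW.
Qed.

Lemma attainable_initial : attainable d m k 0.
Proof.
exists (initial m), 0; split; first exact: reachable_initial.
- by rewrite /row_of mxE.
- by rewrite /initial /row_of mxE lexx.
Qed.

Lemma max_attainable_row_exists : exists n : nat, max_attainable_row d m k n%:Z.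
Proof.
pose P n := `[< attainable d m k n%:Z >].
have exP : exists n, P n by exists 0%N; apply/asboolP/attainable_initial.
have leP n : P n -> (n <= `|(L + 1)%R|)%N.
  by move/asboolP/attainable_le; lia.
have [n /asboolP attn max_n] := ex_maxnP exP leP.
exists n; split=> // -[n' att|n' _] //.
by rewrite lez_nat; apply/max_n/asboolP.
Qed.

Lemma floor_log_attainable : (1 < m)%N -> attainable d m k L.
Proof.
move=> m1; have m2 : 2 <= m%:R :> R by rewrite ler_nat.
have p2 : phi < 2 := knacci_lt2 k1.
have r1 := ratio_ge1; set r := _ / _ in r1.
have rJ : 1 <= r ^+ d.-1 by rewrite exprn_ege1.
have L0 : 0%:Z <= L.
  rewrite le_floor_log expr0 /X capacityE mulrA ler_pdivlMr // mul1r.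
  have : 1 * 1 <= m%:R * r ^+ d.-1 by apply: ler_pM; lra.
  lra.
case EL : L L0 => [n|//] _.
have : phi ^+ n <= X by rewrite -le_floor_log EL.
rewrite /X capacityE mulrA ler_pdivlMr // => le_n.
have [//|M prod le_M] := @produces_dim R d m k k1 0 m d.-1 m0 (produces0 (d:=d) (m:=m) (k:=k)).
rewrite add0n in prod; apply: (attainable_row k1 prod).
apply: le_lt_trans le_n _; rewrite -/r in le_M *.
have le_M' : (m%:R - (phi - 1)) * r ^+ d.-1 * phi <= (M%:R - (phi - 1)) * phi.
  by rewrite ler_pM2r.
(* The difference of the two sides is [(m - phi) * (phi - 1)], positive because [m >= 2 > phi]. *)
have : m%:R < (m%:R - (phi - 1)) * phi.
  have : 0 < (m%:R - phi) * (phi - 1) by rewrite mulr_gt0 //; lra.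
  lra.
rewrite -(ltr_pM2r (lt_le_trans ltr01 rJ)) => lt_m; apply: lt_le_trans lt_m _.
rewrite mulrAC; apply: le_trans le_M' _.
by rewrite ler_pM2r // gerDl oppr_le0 ltW.
Qed.

End Rows.

(** * The golden ratio and the case k = 2 *)

Section Golden.
Context {R : realType}.

Lemma golden_sqr : golden R ^+ 2 = golden R + 1.
Proof.
have s5 : Num.sqrt (5 : R) ^+ 2 = 5 by rewrite sqr_sqrtr ?ler0n.
by rewrite /golden expr_div_n sqrrD s5; field.
Qed.

Lemma knacci2 : knacci R 2 = golden R.
Proof.
have [_ _ uniq_root] := knacciP R (isT : (1 < 2)%N).
apply/esym/uniq_root.
  by rewrite knacci_rootE !big_ord_recr big_ord0 golden_sqr /= expr0 expr1 add0r addrC.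
have s1 : 1 <= Num.sqrt (5 : R) by rewrite -{1}(sqrtr1 R) ler_sqrt; lra.
by rewrite ger0_norm /golden; lra.
Qed.

Local Notation phi := (golden R).

Lemma golden_bounds : 1 < phi < 2.
Proof. by rewrite -knacci2 knacci_gt1 ?knacci_lt2. Qed.

(** Here [phi + 1 = phi ^+ 2] and [phi - 1 = phi ^- 1]. *)
Lemma golden_ratioE : (phi + 1) / (phi - 1) = phi ^+ 3.
Proof.
have /andP[g1 _] := golden_bounds; have g2 := golden_sqr.
have h : phi - 1 != 0 by rewrite gt_eqF // subr_gt0.
apply: (mulIf h); rewrite divfK // exprS g2.
have -> : phi * (phi + 1) * (phi - 1) = phi * (phi ^+ 2 - 1) by ring.
by rewrite g2 addrK -expr2 g2.
Qed.

Lemma golden_capacity d : (0 < d)%N ->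
  (phi + 1) ^+ (d - 1) / (phi - 1) ^+ d = phi ^+ (3 * d - 2).
Proof.
case: d => // d _; have g2 := golden_sqr; have /andP[g1 _] := golden_bounds.
rewrite subn1 /= exprSr invfM mulrA -expr_div_n golden_ratioE -exprM.
have -> : (3 * d.+1 - 2 = 3 * d + 1)%N by lia.
have h : phi - 1 != 0 by rewrite gt_eqF // subr_gt0.
rewrite exprD; congr (_ * _); apply: (mulIf h).
by rewrite mulVf // expr1 mulrBr mulr1 -expr2 g2; ring.
Qed.

(* For d = 3 the line-by-line construction only yields 11 checkers, just short
   of the bound phi ^ 5; the twelve of produces_plane are enough, and their
   margin survives the rounding in all higher dimensions. *)
Lemma produces_last d : (0 < d)%N -> exists2 M, @produces d 1 2 d.-1 M &
  phi ^+ (3 * d.-1) < M%:R * phi.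
Proof.
move=> d0; have /andP[g1 lt2] := golden_bounds; have g2 := golden_sqr.
have k1 : (1 < 2)%N by []. have kE := knacci2.
have [d1|] := eqVneq d.-1 0%N.
  by exists 1%N; [rewrite d1; apply: produces0 | rewrite d1 muln0 expr0 mul1r].
move=> d_n0; have lt0 : (0 < d.-1.+1)%N by [].
have [d2|d_n1] := eqVneq d.-1 1%N.
  (* For [d = 2] a line giving 3 checkers suffices: [phi - 1 < 1] allows [p = 1], and
     [phi ^+ 2 < 3]. *)
  exists (1 + 1 * 2)%N; rewrite d2.
    apply: (produces_line (R := R) k1 lt0 (@produces0 d 1 2)).
    by rewrite kE mul1r invf_gt1; lra.
  have -> : phi ^+ (3 * 1) = phi * phi ^+ 2 by rewrite -exprS.
  by rewrite g2 mulrC ltr_pM2r; lra.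
have d3 : (1 < d.-1)%N by lia.
have [|M] := @produces_dim R d 1 2 k1 2 12 (d.-1 - 2) isT (produces_plane (ltnW d3)).
  by lia.
rewrite kE golden_ratioE -exprM (_ : 2 + (d.-1 - 2) = d.-1)%N; last by lia.
move=> prod le_M; exists M => //.
have -> : (3 * d.-1 = 6 + 3 * (d.-1 - 2))%N by lia.
set q := phi ^+ _ in le_M *.
have q0 : 0 < q by rewrite exprn_gt0; lra.
rewrite exprD -/q.
have -> : phi ^+ 6 = 8 * phi + 5.
  have -> : phi ^+ 6 = (phi ^+ 2) ^+ 3 by rewrite -exprM.
  rewrite g2.
  have -> : (phi + 1) ^+ 3 = phi ^+ 2 * phi + 3 * phi ^+ 2 + 3 * phi + 1 by ring.
  have -> : phi ^+ 2 * phi = phi ^+ 2 + phi by rewrite g2 mulrDl -expr2 g2; ring.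
  by rewrite g2; ring.
(* Without the factor [q], the claim is [8 * phi + 5 < 12 * phi - 1], that is [3 / 2 < phi]. *)
have lo : 3 / 2 < phi.
  by rewrite ltNge; apply/negP => le; move: g2; nra.
apply: (@lt_le_trans _ _ ((12 - (phi - 1)) * q * phi)).
  rewrite mulrAC ltr_pM2r //.
  have -> : (12 - (phi - 1)) * phi = 13 * phi - phi ^+ 2 by ring.
  by rewrite g2; lra.
by rewrite ler_pM2r; lra.
Qed.

(** As [phi * (phi - 1) = 1], the condition for row [3 * d - 2] is the bound of [produces_last]. *)
Lemma attainable_single d : (0 < d)%N -> attainable d 1 2 (3 * d - 2)%N%:Z.
Proof.
move=> d0; have [M prod lt_M] := produces_last d0.
have /andP[g1 _] := golden_bounds; have g2 := golden_sqr.
have k1 : (1 < 2)%N by [].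
apply: (attainable_row (R := R) k1 prod); rewrite knacci2.
have -> : (3 * d - 2 = 3 * d.-1 + 1)%N by lia.
rewrite exprD expr1 -mulrA mulrBr mulr1 -expr2 g2.
by rewrite [phi + 1]addrC addrK mulr1.
Qed.

End Golden.

Theorem theorem1 (R : realType) (d m k : nat)
    (hd : (1 <= d)%N) (hm : (1 <= m)%N) (hk : (2 <= k)%N) :
  exists nM : int,
    [/\ max_attainable_row d m k nM,
        (1 < m)%N ->
          let phi := knacci R k in
          let L := Num.floor (logb phi m%:R +
                     logb phi ((phi + 1) ^+ (d - 1) / (phi - 1) ^+ d)) in
          L <= nM <= L + 1
      & k = 2%N ->
          let L := Num.floor (logb (golden R) m%:R) in
          L + 3 * d%:Z - 2 <= nM <= L + 3 * d%:Z - 1].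
Proof.
have [n [attn max_n]] := @max_attainable_row_exists R d m k hd hm hk.
exists n%:Z; split=> //.
  move=> m1 /=; rewrite (attainable_le (R := R) hd hm hk attn) andbT.
  by apply/max_n/(floor_log_attainable hd hm hk m1).
move=> kE /=; subst k.
have /andP[g1 _] := @golden_bounds R.
have upper := attainable_le (R := R) hd hm hk attn.
have lower := floor_log_attainable (R := R) hd hm hk.
(* The second logarithm is an integer and can leave the floor. *)
have expE : logb (golden R) (golden R ^+ (3 * d - 2)) = (3 * d - 2)%N%:Z%:~R.
  by rewrite /logb lnXn ?(lt_trans ltr01) // -mulr_natl mulfK // gt_eqF // ln_gt0.
rewrite knacci2 golden_capacity // expE floorDrz ?intr_int // intrKfloor in upper lower.
set L := Num.floor (logb _ m%:R) in upper lower *.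
suff : L + (3 * d - 2)%N%:Z <= n%:Z by lia.
have [m1|] := ltnP 1 m; first exact/max_n/lower.
(* For [m = 1] the logarithm of [m] vanishes, and row [3 * d - 2] comes from the construction with
   twelve checkers. *)
move=> m1; have mE : m = 1%N by lia.
rewrite /L mE /logb ln1 mul0r floor0 add0r -mE.
by apply: max_n; rewrite mE; apply: attainable_single.
Qed.
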